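(* Let $X$ be the dendrite and $F\colon X\to X$ the continuous map obtained by the construction described in the context. Then: (i) the map $F$ is exact; (ii) the set of periodic points of $F$ is dense in $X$, and it is included in the set of endpoints of $X$ except for the point $b_\emptyset$ (that is, every periodic point of $F$ other than $b_\emptyset$ is an endpoint of $X$).
   Context: **General notions.** A continuum is a compact, connected, nonempty metric space; a dendrite is a continuum in which any two distinct points can be separated by a third point. An endpoint of a dendrite is a point of order $1$ (it has arbitrarily small open neighborhoods with one-point boundary). $[a,b]$ denotes the unique arc between points $a,b$ of a dendrite. A star with center $a$ is a continuum $S=\bigcup_{n\ge1}B_n$, where the $B_n$ (the beams) are arcs, each having $a$ as an endpoint, with $\lim_n \mathrm{diam}(B_n)=0$ and $B_m\cap B_n=\{a\}$ for $m\ne n$. A continuous map $F\colon X\to X$ is exact if for every nonempty open $U\subset X$ there is $N>0$ with $F^N(U)=X$. A point $x$ is periodic if $F^n(x)=x$ for some $n>0$. $\mathbb{N}=\{1,2,\dots\}$. **The dendrite $X$.** Let $S$ be a star with center $b_\emptyset$ and beams $B_n$, $n\in\mathbb{N}$. In the interior of each beam $B_n$ choose a dense sequence of (distinct) points $(b_{(n,i)})_{i>0}$. At each $b_{(n,i)}$ attach a star $S_{(n,i)}$ with center $b_{(n,i)}$ and beams $B^{(n,i)}_m$ ($m\in\mathbb{N}$), such that $S_{(n,i)}\cap S=\{b_{(n,i)}\}$ and $\mathrm{diam}(S_{(n,i)})<2^{-(n+i)}$. Continue inductively: for every $k\in\mathbb{N}$ and every $\alpha=(n_1,j_1)\dots(n_k,j_k)\in(\mathbb{N}^2)^k$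 a star $S_\alpha$ with center $b_\alpha$ and beams $B^\alpha_m$, $m\in\mathbb{N}$, is attached at $b_\alpha$, with $\mathrm{diam}(S_\alpha)<2^{-\sum_{i=1}^k(n_i+j_i)}$; in the interior of every beam $B^\alpha_m$ choose a dense sequence of (distinct) points $(b_{\alpha(m,j)})_{j>0}$, and at each of these attach the star $S_{\alpha(m,j)}$ so that $S_{\alpha(m,j)}\cap S_\alpha=\{b_{\alpha(m,j)}\}$ (here $\alpha(m,j)$ is the concatenation of $\alpha$ with the pair $(m,j)$). The stars have no other common points than those forced by the attachments, and $$X=\overline{S\cup\bigcup_{k>0}\bigcup_{\alpha\in(\mathbb{N}^2)^k}S_\alpha}$$ is a dendrite. **Subsets of $X$.** For $n\in\mathbb{N}$, $D_n$ is the closure of the connected component of $X\setminus\{b_\emptyset\}$ that contains $B_n\setminus\{b_\emptyset\}$. For $n\in\mathbb{N}$, $D_{(1,n)}$ is the closure of the union of the connected components of $X\setminus\{b_{(1,n)}\}$ that contain the sets $B^{(1,n)}_m\setminus\{b_{(1,n)}\}$, $m\in\mathbb{N}$. **The map $F$.** $F(b_\emptyset)=b_\emptyset$, and $F$ is defined as follows, where ''linearly'' refers to linear parametrizations of the beams (on an arc that passes through several beams, linearly on each piece lying in one beam), and the dense sequences in the beams are placed compatibly so that the maps below exist. - For $n\in\mathbb{N}$, $F|_{D_{n+1}}\colon D_{n+1}\to D_n$ is a homeomorphism mapping linearly each arc $[b_\emptyset,b_{(n+1,j_1)(n_2,j_2)\dots(n_k,j_k)}]$ onto the arc $[b_\emptyset,b_{(n,j_1)(n_2,j_2)\dots(n_k,j_k)}]$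 (with $b_{(n+1,j_1)(n_2,j_2)\dots(n_k,j_k)}\mapsto b_{(n,j_1)(n_2,j_2)\dots(n_k,j_k)}$). - On $D_1$: the beam $B_1$ is collapsed to $b_\emptyset$, and for each $n\in\mathbb{N}$, $F|_{D_{(1,n)}}\colon D_{(1,n)}\to\bigcup_{i\ge n}D_i$ is a homeomorphism mapping linearly each arc $[b_{(1,n)},b_{(1,n)(n_1,j_1)\dots(n_k,j_k)}]$ onto the arc $[b_\emptyset,b_{(n+n_1-1,j_1)(n_2,j_2)\dots(n_k,j_k)}]$ (with $b_{(1,n)}\mapsto b_\emptyset$ and $b_{(1,n)(n_1,j_1)\dots(n_k,j_k)}\mapsto b_{(n+n_1-1,j_1)(n_2,j_2)\dots(n_k,j_k)}$). *)

(* Defs.v *)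
From mathcomp Require Export all_boot all_order all_algebra.
From mathcomp Require Export all_classical all_reals all_analysis.

Set Implicit Arguments.
Unset Strict Implicit.
Unset Printing Implicit Defensive.

Import Order.TTheory GRing.Theory Num.Theory.
Import numFieldNormedType.Exports.

Local Open Scope classical_set_scope.
Local Open Scope ring_scope.

(* Extended-real valued, so that no boundedness proviso is needed. *)
Definition diam (R : realType) (X : metricType R) (A : set X) : \bar R :=
  ereal_sup [set (mdist xy.1 xy.2)%:E | xy in A `*` A].

Definition continuum (R : realType) (X : metricType R) (A : set X) : Prop :=
  [/\ compact A, connected A & A !=set0].

Definition dendrite (R : realType) (X : metricType R) : Prop :=
  continuum [set: X] /\
  forall x y : X, x <> y ->
    exists (z : X) (U V : set X),
      [/\ separated U V, ~` [set z] = U `|` V, U x & V y].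

Definition boundary (T : topologicalType) (A : set T) : set T :=
  closure A `\` interior A.

Definition endpoint (T : topologicalType) (x : T) : Prop :=
  forall U : set T, nbhs x U ->
    exists V : set T, [/\ open V, V x, V `<=` U &
      exists y, boundary V = [set y]].

Definition homeomorphism_on (T T' : topologicalType) (A : set T) (A' : set T')
    (f : T -> T') : Prop :=
  [/\ set_bij A A' f, {within A, continuous f} &
    exists g : T' -> T, {within A', continuous g} /\
      forall x, A x -> g (f x) = x].

(* A continuous injection of the compact [0, 1] into a metric space is a
   homeomorphism onto its image. *)
Definition arc_param (R : realType) (X : metricType R)
    (p : R -> X) (A : set X) : Prop :=
  [/\ {within `[0, 1], continuous p},
      {in `[0, 1] &, injective p} & p @` `[0, 1] = A].

Definition is_arc (R : realType) (X : metricType R)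
    (x y : X) (A : set X) : Prop :=
  exists p : R -> X, [/\ arc_param p A, p 0 = x & p 1 = y].

Definition is_star (R : realType) (X : metricType R)
    (a : X) (B : nat -> set X) (S : set X) : Prop :=
  [/\ continuum S,
      S = \bigcup_n B n,
      forall n, exists y, is_arc a y (B n),
      diam (B n) @[n --> \oo] --> (0 : \bar R)%E &
      forall m n, m <> n -> B m `&` B n = [set a]].

(* Union of the connected components of A that contain the set B; for B
   nonempty there is at most one such component. *)
Definition component_containing (T : topologicalType) (A B : set T) : set T :=
  \bigcup_(x in [set x | A x /\ B `<=` connected_component A x])
    connected_component A x.

Definition exact_map (T : topologicalType) (F : T -> T) : Prop :=
  forall U : set T, open U -> U !=set0 ->
    exists2 N : nat, (0 < N)%N & iter N F @` U = [set: T].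

Definition periodic_point (T : Type) (F : T -> T) (x : T) : Prop :=
  exists2 n : nat, (0 < n)%N & iter n F x = x.

(* All indices are shifted by one: the natural number k stands for the index
   k + 1 of N = {1, 2, ...}.  Thus (n, j) below is the pair (n + 1, j + 1), and
   B_1, b_(1,n), D_(1,n) are indexed by 0 in their first coordinate.  The
   empty word indexes the initial star S.  *)
Definition word : Type := seq (nat * nat).

Definition weight (w : word) : nat := (\sum_(i <- w) (i.1.+1 + i.2.+1))%N.

(* A family of stars is given by the centers [b w] and by linear
   parametrizations [p w m] of the beams, which start at the center. *)
Definition beam (R : realType) (X : metricType R)
    (p : word -> nat -> R -> X) (w : word) (m : nat) : set X :=
  p w m @` `[0, 1].

Definition star (R : realType) (X : metricType R)
    (p : word -> nat -> R -> X) (w : word) : set X :=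
  \bigcup_m beam p w m.

Record star_dendrite (R : realType) (X : metricType R)
    (b : word -> X) (p : word -> nat -> R -> X) : Prop := StarDendrite {
  sd_dendrite : dendrite X ;
  sd_star : forall w, is_star (b w) (beam p w) (star p w) ;
  sd_param : forall w m, arc_param (p w m) (beam p w m) ;
  sd_center : forall w m, p w m 0 = b w ;
  sd_interior : forall w m j, (p w m @` `]0, 1[) (b (rcons w (m, j))) ;
  sd_distinct : forall w m, injective (fun j => b (rcons w (m, j))) ;
  sd_dense : forall w m,
    beam p w m `<=` closure (range (fun j => b (rcons w (m, j)))) ;
  sd_diam : forall w, w <> [::] ->
    (diam (star p w) < (2 ^- weight w)%:E)%E ;
  sd_attach : forall w m j,
    star p (rcons w (m, j)) `&` star p w = [set b (rcons w (m, j))] ;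
  sd_disjoint : forall v w, v <> w ->
    (forall i, w <> rcons v i) -> (forall i, v <> rcons w i) ->
    star p v `&` star p w = set0 ;
  sd_closure : closure (\bigcup_w star p w) = [set: X]
}.

(* [D_ b p n] is D_n, [D1_ b p n] is D_(1,n).  *)
Definition D_ (R : realType) (X : metricType R)
    (b : word -> X) (p : word -> nat -> R -> X) (n : nat) : set X :=
  closure (component_containing (~` [set b [::]])
             (beam p [::] n `\ b [::])).

Definition D1_ (R : realType) (X : metricType R)
    (b : word -> X) (p : word -> nat -> R -> X) (n : nat) : set X :=
  closure (\bigcup_m component_containing (~` [set b [:: (0%N, n)]])
             (beam p [:: (0%N, n)] m `\ b [:: (0%N, n)])).

(* On each piece of A lying in one beam, F is affine in the beam parameters. *)
Definition linear_on (R : realType) (X : metricType R)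
    (p : word -> nat -> R -> X) (F : X -> X) (A : set X) : Prop :=
  forall w m, exists v l (c d : R), forall s : R,
    0 <= s <= 1 -> A (p w m s) ->
    0 <= c * s + d <= 1 /\ F (p w m s) = p v l (c * s + d).

(* F maps the arc [x, y] linearly onto the arc [x', y'], x to x', y to y'.
   Arcs between distinct points of a dendrite exist and are unique. *)
Definition maps_arc_linearly (R : realType) (X : metricType R)
    (p : word -> nat -> R -> X) (F : X -> X) (x y x' y' : X) : Prop :=
  [/\ F x = x', F y = y' &
    forall A A' : set X, is_arc x y A -> is_arc x' y' A' ->
      F @` A = A' /\ linear_on p F A].

Record star_dendrite_map (R : realType) (X : metricType R)
    (b : word -> X) (p : word -> nat -> R -> X) (F : X -> X) : Prop :=
  StarDendriteMap {
  sdm_continuous : continuous F ;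
  sdm_center : F (b [::]) = b [::] ;
  sdm_shift : forall n,
    homeomorphism_on (D_ b p n.+1) (D_ b p n) F ;
  sdm_shift_linear : forall n j w,
    maps_arc_linearly p F (b [::]) (b ((n.+1, j) :: w))
                          (b [::]) (b ((n, j) :: w)) ;
  sdm_collapse : F @` beam p [::] 0%N = [set b [::]] ;
  sdm_unfold : forall n,
    homeomorphism_on (D1_ b p n) (\bigcup_(i in [set i | (n <= i)%N]) D_ b p i)
      F ;
  (* (n+1) + (m+1) - 1 = (n + m) + 1 *)
  sdm_unfold_linear : forall n m j w,
    maps_arc_linearly p F (b [:: (0%N, n)]) (b ((0%N, n) :: (m, j) :: w))
                          (b [::]) (b ((n + m, j)%N :: w))
}.

(* Main.v *)
(** On the centers, F acts on words: after [time w] steps it sends every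
    b (w ++ v) to b v.  By density and compactness, F^(time w) maps the closed
    branch K_w hanging at b w onto X, and every nonempty open set contains some
    K_w: this gives exactness.  Moreover F^(time w) maps K_(w^(n+1)) into
    K_(w^n) and the diameters of the K_(w^n) tend to 0, so their common point
    is periodic.  Finally, F eventually maps every point of a star to the root,
    so a periodic point other than the root lies on no star; such a point is in
    arbitrarily small branches K_w, and K_w minus b w is open with boundary
    {b w}. *)

Require Import Defs.
From mathcomp Require Import all_boot all_order all_algebra.
From mathcomp Require Import all_classical all_reals all_analysis.
From mathcomp Require Import lra zify.

Local Open Scope classical_set_scope.

Import Order.TTheory GRing.Theory Num.Theory.
Local Open Scope ring_scope.

(** * Preliminaries on closures, distances and iteration *)

Lemma continuous_iter (T : topologicalType) (f : T -> T) (n : nat) :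
  continuous f -> continuous (iter n f).
Proof.
move=> cf; elim: n => [|n IHn] x; first exact: cvg_id.
exact: continuous_comp (IHn x) (cf _).
Qed.

Lemma closure_image (T U : topologicalType) (f : T -> U) (A : set T) (x : T) :
  {for x, continuous f} -> closure A x -> closure (f @` A) (f x).
Proof.
move=> cf clAx B /cf fB; have [y [Ay By]] := clAx _ fB.
by exists (f y); split => //; exists y.
Qed.

Lemma closure_mdist_le (R : realType) (X : metricType R) (A : set X) (c : X)
    (r : R) :
  (forall y, A y -> mdist c y <= r) -> forall y, closure A y -> mdist c y <= r.
Proof.
move=> Ar y clAy; rewrite leNgt; apply/negP => ry.
have [] := clAy (ball y (mdist c y - r)).
  by apply: nbhsx_ballx; rewrite subr_gt0.
move=> z [/Ar Az]; rewrite ballEmdist /= metric_sym => zy.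
have := metric_triangle c z y; lra.
Qed.

Lemma mdist_diam (R : realType) (X : metricType R) (A : set X) (x y : X)
    (r : R) :
  (diam A < r%:E)%E -> A x -> A y -> mdist x y <= r.
Proof.
move=> Ar Ax Ay; rewrite -lee_fin; apply: le_trans (ltW Ar).
by apply: ereal_sup_ubound; exists (x, y).
Qed.

Lemma exists_expr2N_lt (R : realType) (e : R) :
  0 < e -> exists n, forall m, (n <= m)%N -> 2 ^- m < e.
Proof.
move=> e0; exists (Num.truncn e^-1) => m nm.
rewrite -[ltRHS]invrK ltf_pV2 ?posrE ?invr_gt0 ?exprn_gt0 //.
apply: lt_le_trans (truncnS_gt _) _.
rewrite -natrX ler_nat; apply: leq_trans (ltn_expl _ (ltnSn 1)).
by rewrite ltnS.
Qed.

Lemma iter_periodic (T : Type) (f : T -> T) (n k : nat) (x : T) :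
  iter n f x = x -> iter (k * n) f x = x.
Proof. by move=> fx; elim: k => // k IHk; rewrite mulSn iterD IHk. Qed.

(** * Words, weights and erasing times *)

Section words.
Implicit Types (u v w : word).

Lemma weight_cat v w : weight (v ++ w) = (weight v + weight w)%N.
Proof. by rewrite /weight big_cat. Qed.

Lemma weight_rcons w i : weight (rcons w i) = (weight w + (i.1.+1 + i.2.+1))%N.
Proof. by rewrite -cats1 weight_cat /weight big_seq1. Qed.

Lemma size_weight w : (size w <= weight w)%N.
Proof.
elim: w => // i w IHw; rewrite /weight big_cons addSn ltnS.
exact: leq_trans IHw (leq_addl _ _).
Qed.

(* The number of iterates of F after which the prefix w is erased. *)
Definition time w : nat := (\sum_(i <- w) (i.1 + i.2).+1)%N.

Lemma time_gt0 w : w <> [::] -> (0 < time w)%N.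
Proof. by case: w => // i w _; rewrite /time big_cons. Qed.

Definition wpow w (n : nat) : word := iter n (cat w) [::].

Lemma wpowD w m n : wpow w (m + n) = wpow w m ++ wpow w n.
Proof. by elim: m => //= m IHm; rewrite -/(wpow _ _) IHm catA. Qed.

Lemma wpow_weight w n : w <> [::] -> (n <= weight (wpow w n))%N.
Proof.
move=> w0; elim: n => // n IHn; rewrite weight_cat -add1n leq_add //.
by case: w w0 {IHn} => // i w _; rewrite /weight big_cons.
Qed.

Lemma prefix_rconsr u v i : prefix u v -> prefix u (rcons v i).
Proof. by move=> uv; rewrite -cats1 prefix_catl. Qed.

(** The word of the image of [b ((0, n) :: w)] under F: with shifted indices, n + n_1 - 1 becomes a
    plain sum. The empty word stays empty because b_(1,n) goes to the root. *)
Definition raise (n : nat) w : word :=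
  if w is i :: v then (n + i.1, i.2)%N :: v else [::].

End words.

Section star_dendrite.
Context {R : realType} {X : metricType R}.
Context {b : word -> X} {p : word -> nat -> R -> X}.
Hypothesis hX : star_dendrite b p.
Implicit Types (u v w : word) (x y : X) (U : set X).

Let X_compact : compact [set: X].
Proof. by case: (sd_dendrite hX) => -[]. Qed.

Let X_hausdorff : hausdorff_space X.
Proof. exact: metric_hausdorff. Qed.

(** * Stars, beams and density of the centers *)

Lemma star_closed w : closed (star p w).
Proof. by apply: compact_closed => //; case: (sd_star hX w) => -[]. Qed.

Lemma star_connected w : connected (star p w).
Proof. by case: (sd_star hX w) => -[]. Qed.

Lemma beam_center w m : beam p w m (b w).
Proof.
exists 0; last exact: sd_center.
by rewrite /= bound_itvE.
Qed.

Lemma star_center w : star p w (b w).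
Proof. by exists 0%N => //; exact: beam_center. Qed.

Lemma beam_child w m j : beam p w m (b (rcons w (m, j))).
Proof.
have [s s01 <-] := sd_interior hX w m j; exists s => //.
exact: subset_itv_oo_cc.
Qed.

Lemma star_child w i : star p w (b (rcons w i)).
Proof. by case: i => m j; exists m => //; exact: beam_child. Qed.

Lemma beam_closed w m : closed (beam p w m).
Proof.
have [cp _ <-] := sd_param hX w m.
apply: compact_closed => //; apply: continuous_compact => //.
exact: segment_compact.
Qed.

Lemma child_neq w i : b (rcons w i) <> b w.
Proof.
case: i => m j; have [s s01 <-] := sd_interior hX w m j.
rewrite -(sd_center hX w m) => ps0.
have [_ pI _] := sd_param hX w m.
have s0 : s = 0.
  apply: pI => //; last by rewrite bound_itvE.
  exact: subset_itv_oo_cc s01.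
by move: s01; rewrite /= s0 in_itv /= ltxx.
Qed.

Lemma star_mdist w x y :
  w <> [::] -> star p w x -> star p w y -> mdist x y <= 2 ^- weight w.
Proof. by move=> w0; apply: mdist_diam; exact: (sd_diam hX). Qed.

Lemma closure_centers : closure (range b) = [set: X].
Proof.
rewrite -(sd_closure hX) eqEsubset; split.
  by apply: closureS => _ [w _ <-]; exists w => //; exact: star_center.
rewrite [X in _ `<=` X](closure_id _).1; last exact: closed_closure.
apply: closureS => x [w _ [m _ /(sd_dense hX)]]; apply: closureS.
by move=> _ [j _ <-]; exists (rcons w (m, j)).
Qed.

(** Beam 0 starts at [b w] and its children are dense in it; the first [k] children all differ from
    [b w], so a smaller neighborhood avoids them. *)
Lemma center_limit w (k : nat) U : nbhs (b w) U ->
  exists2 j, (k <= j)%N & U (b (rcons w (0%N, j))).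
Proof.
move=> Ub.
have near_neq (i : 'I_k) : \forall y \near b w, y <> b (rcons w (0%N, i : nat)).
  apply: open_nbhs_nbhs; split; last exact/nesym/child_neq.
  apply: closed_openC; apply: accessible_closed_set1.
  exact: hausdorff_accessible.
have := sd_dense hX (beam_center w 0).
move=> /(_ _ (filterI Ub (filter_forall _ near_neq))).
move=> [_ [[j _ <-] [Uj jk]]]; exists j => //.
by rewrite leqNgt; apply/negP => jltk; exact: (jk (Ordinal jltk)).
Qed.

(** * Branches: size, connectedness, separation and endpoints *)

Definition branch w : set X := \bigcup_(v in [set v | prefix w v]) star p v.

(** For nonempty [w], the closures of [branch w] and [cobranch w] cover X and meet only in [b w];
    the first closure is K_w. *)
Definition cobranch w : set X := \bigcup_(v in [set v | ~~ prefix w v]) star p v.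

Lemma branch_center w v : branch w (b (w ++ v)).
Proof. by exists (w ++ v); [exact: prefix_prefix | exact: star_center]. Qed.

(** A chain of stars leads from [b w] to [y], and their diameter bounds are dominated by a geometric
    series. *)
Lemma branch_mdist w y : w <> [::] -> branch w y ->
  mdist (b w) y <= 2 * 2 ^- weight w.
Proof.
move=> w0 [_ /prefixP[v ->] wvy]; move: w w0 wvy.
elim: v => [|i v IHv] w w0 wvy.
  have := star_mdist _ _ _ w0 (star_center w) _; rewrite cats0 in wvy.
  move=> /(_ _ wvy); have := exprn_gt0 (weight w) (@ltr0Sn R 1).
  rewrite -invr_gt0; lra.
rewrite -cat_rcons in wvy.
have bi := star_mdist _ _ _ w0 (star_center w) (star_child w i).
have iy : mdist (b (rcons w i)) y <= 2 * 2 ^- weight (rcons w i).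
  by apply: IHv => //; case: (w).
(* The added letter increases the weight by at least one, which absorbs the factor 2. *)
have : 2 * 2 ^- weight (rcons w i) <= 2 ^- weight w :> R.
  rewrite weight_rcons addSn addnS exprS invfM mulrA divff ?pnatr_eq0 // mul1r.
  rewrite lef_pV2 ?posrE ?exprn_gt0 // ler_weXn2l ?ler1n //.
  exact: leq_addr.
have := metric_triangle (b w) (b (rcons w i)) y; lra.
Qed.

Lemma closure_branch_mdist w y : w <> [::] -> closure (branch w) y ->
  mdist (b w) y <= 2 * 2 ^- weight w.
Proof. by move=> w0; apply: closure_mdist_le => z; exact: branch_mdist. Qed.

Lemma small_branch U : open U -> U !=set0 ->
  exists2 w, w <> [::] & closure (branch w) `<=` U.
Proof.
move=> oU [x Ux].
have /(_ U (open_nbhs_nbhs (conj oU Ux))) : closure (range b) x.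
  by rewrite closure_centers.
move=> [_ [[w _ <-] Uw]].
have /nbhs_ballP[e /= e0 eU] := open_nbhs_nbhs (conj oU Uw).
(* The budget [e] is split into e/2 from [b w] to a child of large index and 2 * (e/4) for the
   branch at that child. *)
have [n n_e] := exists_expr2N_lt _ _ (divr_gt0 e0 (@ltr0Sn R 3)).
have [j nj wj] := 
  center_limit w n _ (nbhsx_ballx (b w) _ (divr_gt0 e0 (@ltr0Sn R 1))).
have w0 : rcons w (0%N, j) <> [::] by case: (w).
exists (rcons w (0%N, j)) => // y /(closure_branch_mdist _ _ w0) jy.
apply: eU; rewrite ballEmdist /=; rewrite ballEmdist /= in wj.
have /n_e : (n <= weight (rcons w (0%N, j)))%N.
  by rewrite weight_rcons /=; lia.
have := metric_triangle (b w) (b (rcons w (0%N, j))) y; lra.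
Qed.

(** The words in [P] form a tree with root [u], and each star contains the centers of its children;
    induction along the path from [u] puts every star in the component of [b u]. *)
Lemma star_union_connected (P : set word) u : P u ->
  (forall w, P w -> prefix u w) ->
  (forall w i, prefix u w -> P (rcons w i) -> P w) ->
  connected (\bigcup_(w in P) star p w).
Proof.
move=> Pu uP PP; set A := \bigcup_(w in P) star p w.
have Asub v : P (u ++ v) -> star p (u ++ v) `<=` connected_component A (b u).
  elim/last_ind: v => [|v i IHv] Pv.
    rewrite cats0; apply: connected_component_max; first exact: star_center.
      by move=> y uy; exists u.
    exact: star_connected.
  rewrite -rcons_cat in Pv *.
  move=> y yv; apply: connected_component_trans.
    apply: IHv (star_child _ i); apply: PP Pv; exact: prefix_prefix.
  apply: connected_component_max yv; first exact: star_center.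
    by move=> z zv; exists (rcons (u ++ v) i).
  exact: star_connected.
suff -> : A = connected_component A (b u) by exact: component_connected.
rewrite eqEsubset; split; last exact: connected_component_sub.
move=> y [w Pw wy]; have /prefixP[v wE] := uP _ Pw.
by rewrite wE in Pw wy; exact: Asub Pw _ wy.
Qed.

Lemma branch_connected w : connected (branch w).
Proof.
apply: (star_union_connected _ w) => //=; first exact: prefix_refl.
Qed.

Lemma cobranch_connected w : w <> [::] -> connected (cobranch w).
Proof.
move=> w0; apply: (star_union_connected _ [::]) => /=.
- by case: w w0.
- by move=> v _; exact: prefix0s.
- by move=> v i _; apply: contra; exact: prefix_rconsr.
Qed.

(** Distinct stars meet only for a parent and its child. If exactly one of the two words extends
    [w], they are [w] and its parent, whose stars meet in [b w]. *)
Lemma branch_cobranch w y : branch w y -> cobranch w y -> y = b w.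
Proof.
move=> [_ /prefixP[v ->] wvy] [v' /= wv' v'y].
have vv' : w ++ v <> v'.
  by move=> vE; rewrite -vE prefix_prefix in wv'.
have [[i vE]|nv] := pselect (exists i, v' = rcons (w ++ v) i).
  by rewrite vE prefix_rconsr ?prefix_prefix in wv'.
have [[i vE]|nv'] := pselect (exists i, w ++ v = rcons v' i); last first.
  have : (star p (w ++ v) `&` star p v') y by [].
  rewrite (sd_disjoint hX) // => i vE; first by apply: nv; exists i.
  by apply: nv'; exists i.
(* For nonempty [v] the parent [v'] would still extend [w]. *)
case/lastP: v vE {vv' nv} wvy => [|v k] vE wvy.
  rewrite cats0 in vE wvy; case: i vE => m j wE; rewrite wE in wvy *.
  have : (star p (rcons v' (m, j)) `&` star p v') y by [].
  by rewrite (sd_attach hX).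
move: vE; rewrite -rcons_cat => /rcons_inj[vE _].
by rewrite -vE prefix_prefix in wv'.
Qed.

Lemma cobranch_center w : w <> [::] -> cobranch w (b w).
Proof.
case/lastP: w => // w i _; exists w; last exact: star_child.
apply/negP => /prefixP[v /(congr1 size)].
by rewrite size_cat size_rcons; lia.
Qed.

Lemma closure_branchU w : closure (branch w) `|` closure (cobranch w) = [set: X].
Proof.
rewrite -closureU -bigcup_setU -(sd_closure hX); congr closure.
apply: eq_bigcupl; split => // v _.
by case: (boolP (prefix w v)) => ?; [left|right].
Qed.

(* A point separating y from b w would lie in both connected sets branch w and
   cobranch w, which contain b w and have y in their closures. *)
Lemma closure_branchI w y : w <> [::] ->
  closure (branch w) y -> closure (cobranch w) y -> y = b w.
Proof.
move=> w0 By Cy; apply: contrapT => yw.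
have [z [U [V [sUV zUV Uy Vw]]]] := (sd_dendrite hX).2 _ _ yw.
have nz t : (U `|` V) t -> z <> t by rewrite -zUV => tz /esym.
have zw := nz (b w) (or_intror Vw).
have through A : connected A -> A (b w) -> closure A y -> A z.
  move=> cA Aw clAy; apply: contrapT => Az.
  have AUV : A `<=` U `|` V by rewrite -zUV => t At tz; rewrite tz in At.
  have [AU|AV] := connected_subset sUV AUV cA.
    have : (U `&` V) (b w) by split => //; exact: AU.
    by rewrite (separated_disjoint sUV).
  have : (U `&` closure V) y by split => //; exact: closureS clAy.
  by rewrite sUV.2.
apply: zw; apply: branch_cobranch.
  apply: through => //; first exact: branch_connected.
  by rewrite -{2}[w]cats0; exact: branch_center.
apply: through => //; first exact: cobranch_connected.
exact: cobranch_center.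
Qed.

(** Otherwise a neighborhood of [y] misses the star at [w] and the finitely many child branches with
    both indices below [n]. Any other child branch is so small that, if it came near [y], so would
    its center, which lies on that star. *)
Lemma closure_branch_step w y : (forall v, ~ star p v y) ->
  closure (branch w) y -> exists i, closure (branch (rcons w i)) y.
Proof.
move=> nstar clwy; apply: contrapT => /forallNP nchild.
have /nbhs_ballP[e /= e0 ew] : nbhs y (~` star p w).
  by apply: open_nbhs_nbhs; split; [exact/closed_openC/star_closed|exact: nstar].
have [n n_e] := exists_expr2N_lt _ _ (divr_gt0 e0 (@ltr0Sn R 3)).
have away (i : 'I_n * 'I_n) :
    \forall z \near y, ~ branch (rcons w (i.1 : nat, i.2 : nat)) z.
  have yC : nbhs y (~` closure (branch (rcons w (i.1 : nat, i.2 : nat)))).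
    apply: open_nbhs_nbhs; split; last exact: nchild.
    exact/closed_openC/closed_closure.
  by apply: filterS yC => z; apply: contra_not; exact: subset_closure.
have ye := nbhsx_ballx y _ (divr_gt0 e0 (@ltr0Sn R 1)).
have := clwy _ (filterI ye (filter_forall _ away)).
move=> [z [[_ /prefixP[[|[m j] v] ->] zw] [yz zaway]]].
  rewrite cats0 in zw; apply: ew zw; apply: le_ball yz; lra.
have {zw} zi : branch (rcons w (m, j)) z.
  by exists (w ++ (m, j) :: v) => //=; rewrite -cat_rcons prefix_prefix.
have [/andP[mn jn]|nmj] := boolP ((m < n) && (j < n))%N.
  exact: (zaway (Ordinal mn, Ordinal jn)).
have /n_e wi : (n <= weight (rcons w (m, j)))%N by rewrite weight_rcons /=; lia.
have i0 : rcons w (m, j) <> [::] by case: (w).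
apply: ew (star_child w (m, j)); rewrite !ballEmdist /= in yz *.
have := branch_mdist _ _ i0 zi; rewrite metric_sym.
have := metric_triangle y z (b (rcons w (m, j))); lra.
Qed.

Lemma closure_branch_size y : (forall v, ~ star p v y) ->
  forall n, exists2 w, size w = n & closure (branch w) y.
Proof.
move=> nstar; elim=> [|n [w sw wy]].
  exists [::] => //; have : [set: X] y by [].
  rewrite -(sd_closure hX); apply: closureS => z [v _ vz].
  by exists v => //=; exact: prefix0s.
have [i wi] := closure_branch_step _ _ nstar wy.
by exists (rcons w i); rewrite ?size_rcons ?sw.
Qed.

Lemma nonstar_endpoint y : (forall v, ~ star p v y) -> endpoint y.
Proof.
move=> nstar U /nbhs_ballP[e /= e0 eU].
have [n n_e] := exists_expr2N_lt _ _ (divr_gt0 e0 (@ltr0Sn R 3)).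
(* Length [n.+1] makes [w] nonempty and of weight at least [n]; two points of K_w are then less than
   4 * (e/4) apart. *)
have [w sw wy] := closure_branch_size _ nstar n.+1.
have w0 : w <> [::] by case: (w) sw.
have /n_e we : (n <= weight w)%N by have := size_weight w; lia.
(* This is K_w minus [b w], written as a complement to make it open. *)
pose V := ~` closure (cobranch w).
have oV : open V by exact/closed_openC/closed_closure.
have Vbranch : V `<=` closure (branch w).
  move=> z Vz; have : [set: X] z by [].
  by rewrite -(closure_branchU w) => -[].
have nVw : ~ V (b w) by apply; exact/subset_closure/cobranch_center.
have VP z : closure (branch w) z -> z <> b w -> V z.
  by move=> wz zw Cz; apply: zw; exact: closure_branchI wz Cz.
exists V; split => //.
- by apply: VP => // yw; apply: (nstar w); rewrite yw; exact: star_center.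
- move=> z /Vbranch/(closure_branch_mdist _ _ w0) wz; apply: eU.
  rewrite ballEmdist /=; have := closure_branch_mdist _ _ w0 wy.
  by have := metric_triangle y (b w) z; rewrite (metric_sym y (b w)); lra.
- exists (b w); rewrite /boundary (interior_id _).1 // eqEsubset.
  split=> [z [clVz nVz]|_ ->].
    have wz : closure (branch w) z.
      by apply: closed_closure; exact: closureS clVz.
    by apply: contrapT => zw; apply: nVz; exact: VP.
  (* [b w] is adherent to [V], since children of [w] accumulate there. *)
  split => // O /(center_limit w 0)[j _ Oj].
  exists (b (rcons w (0%N, j))); split => //; apply: VP; last exact: child_neq.
  by rewrite -cats1; exact/subset_closure/branch_center.
Qed.

(** * Action of F on centers and stars; periodic points *)

Context {F : X -> X}.
Hypothesis hF : star_dendrite_map b p F.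

Lemma map_shift n j w : F (b ((n.+1, j) :: w)) = b ((n, j) :: w).
Proof. by case: (sdm_shift_linear hF n j w). Qed.

Lemma map_unfold n w : F (b ((0%N, n) :: w)) = b (raise n w).
Proof.
case: w => [|[m j] w]; last by case: (sdm_unfold_linear hF n m j w).
(* That b_(1,n) goes to the root is the initial-point clause of any of the arc maps; the child
   chosen is arbitrary. *)
by case: (sdm_unfold_linear hF n 0 0 [::]).
Qed.

Lemma iter_root n : iter n F (b [::]) = b [::].
Proof. by apply: iter_fix; exact: sdm_center hF. Qed.

Lemma iter_raise n w : iter n F (b (raise n w)) = b w.
Proof.
case: w => [|[m j] w]; first exact: iter_root.
by elim: n => //= n IHn; rewrite -iterS iterSr addSn map_shift.
Qed.

Lemma iter_head m j w : iter m F (b ((m, j) :: w)) = b ((0%N, j) :: w).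
Proof. by elim: m => // m IHm; rewrite iterSr map_shift. Qed.

(** A letter (m, j) costs m shifts to reach (0, j), one unfolding that deletes it and raises the
    next letter by j, and j shifts that undo the raise. *)
Lemma iter_time w v : iter (time w) F (b (w ++ v)) = b v.
Proof.
elim: w v => [|[m j] w IHw] v; first by rewrite /time big_nil.
have step : iter (m + j).+1 F (b ((m, j) :: w ++ v)) = b (w ++ v).
  by rewrite addnC -addSn iterD iter_head iterSr map_unfold iter_raise.
by rewrite /time big_cons -/(time w) addnC iterD [X in iter _ _ X]step IHw.
Qed.

(** After [time w] steps the children on beam [m] of the star at [w] lie on beam [m] of the root,
    and after [m] more on beam 0. By density the whole beam follows, and F collapses beam 0. *)
Lemma iter_star w y : star p w y -> exists n, iter n F y = b [::].
Proof.
move=> [m _ wy]; pose n := (m + time w)%N; exists n.+1.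
suff : (F @` beam p [::] 0%N) (F (iter n F y)) by rewrite (sdm_collapse hF).
exists (iter n F y) => //; apply: beam_closed.
have cF := continuous_iter _ _ n (sdm_continuous hF).
apply: closureS (closure_image _ _ _ _ _ (cF y) (sd_dense hX wy)).
move=> _ [_ [j _ <-] <-]; rewrite -cats1 iterD iter_time iter_head.
exact: (beam_child [::]).
Qed.

Lemma periodic_star w y : periodic_point F y -> star p w y -> y = b [::].
Proof.
move=> [n n0 ny] /iter_star[k ky].
(* The multiple [k * n] of the period is at least [k], so by that time the orbit has reached the
   fixed root. *)
rewrite -(iter_periodic _ _ _ k _ ny) -(subnK (leq_pmulr k n0)) iterD ky.
exact: iter_root.
Qed.

(** The image is compact, hence closed, and contains every center. *)
Lemma iter_closure_branch w :
  iter (time w) F @` closure (branch w) = [set: X].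
Proof.
have cF := continuous_iter _ _ (time w) (sdm_continuous hF).
have cl : closed (iter (time w) F @` closure (branch w)).
  apply: compact_closed => //; apply: continuous_compact.
    exact: continuous_subspaceT.
  by apply: (subclosed_compact _ X_compact) => //; exact: closed_closure.
rewrite -subTset -closure_centers; apply: subset_trans cl; apply: closureS.
move=> _ [v _ <-]; exists (b (w ++ v)); last exact: iter_time.
exact/subset_closure/branch_center.
Qed.

Lemma branch_periodic w : w <> [::] ->
  exists2 y, closure (branch w) y & periodic_point F y.
Proof.
move=> w0.
(* Compactness gives a cluster point of the centers of the powers of [w]; it lies in every [K n],
   because later powers extend the [n]-th one. *)
have [y [_ cly]] := X_compact (b (wpow w n) @[n --> \oo]) _ filterT.
(* Only centers generate [K n], since [iter_time] describes the iterates on centers alone. *)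
pose K n := closure [set b (wpow w n ++ v) | v in [set: word]].
have Ky n : K n y.
  move=> O Oy; have [] := cly [set b (wpow w n ++ v) | v in [set: word]] O _ Oy.
    by exists n => // k /= nk; exists (wpow w (k - n)) => //; rewrite -wpowD subnKC.
  by move=> z; exists z.
have Kbranch n : K n `<=` closure (branch (wpow w n)).
  by apply: closureS => _ [v _ <-]; exact: branch_center.
exists y; first by have /Kbranch := Ky 1; rewrite /wpow /= cats0.
exists (time w); first exact: time_gt0.
have cF := continuous_iter _ _ (time w) (sdm_continuous hF).
have KFy n : K n (iter (time w) F y).
  apply: closureS (closure_image _ _ _ _ _ (cF y) (Ky n.+1)).
  move=> _ [_ [v _ <-] <-]; exists v => //.
  by rewrite /wpow /= -catA iter_time.
(* [y] and its image both lie in every [K n]; a distance d > 0 is refuted once both are within 2 *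
   2^-weight < d/2 of the same center. *)
apply: contrapT => /eqP; rewrite -mdist_gt0 => d0.
have [n n_d] := exists_expr2N_lt _ _ (divr_gt0 d0 (@ltr0Sn R 3)).
have wn0 : wpow w n.+1 <> [::] by case: (w) w0.
have /n_d wd : (n <= weight (wpow w n.+1))%N.
  exact: leq_trans (wpow_weight _ _ w0).
have := closure_branch_mdist _ _ wn0 (Kbranch _ _ (Ky n.+1)).
have := closure_branch_mdist _ _ wn0 (Kbranch _ _ (KFy n.+1)).
have := metric_triangle (iter (time w) F y) (b (wpow w n.+1)) y.
rewrite (metric_sym _ (b _)); lra.
Qed.

End star_dendrite.

Theorem theorem5p1 (R : realType) (X : metricType R)
    (b : word -> X) (p : word -> nat -> R -> X) (F : X -> X)
    (hX : star_dendrite b p) (hF : star_dendrite_map b p F) :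
  exact_map F /\
  (dense [set x | periodic_point F x] /\
   forall x : X, periodic_point F x -> x <> b [::] -> endpoint x).
Proof.
split; last split.
- move=> U oU U0; have [w w0 wU] := small_branch hX _ oU U0.
  exists (time w); first exact: time_gt0.
  rewrite -subTset -(iter_closure_branch hX hF w).
  exact: image_subset.
- move=> U U0 oU; have [w w0 wU] := small_branch hX _ oU U0.
  have [y wy py] := branch_periodic hX hF _ w0.
  by exists y; split => //; exact: wU.
- move=> x px xr; apply: (nonstar_endpoint hX) => w wx.
  exact: xr (periodic_star hX hF _ _ px wx).
Qed.
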